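(* Let $S$ be a semidomain, and consider the following statements. (a) $S$ is quasi-atomic and, for every indecomposable polynomial $\sum_{i=0}^n c_i x^i \in S[x]\setminus\{0\}$, the set $\mathrm{mcd}_S(c_0,\dots,c_n)$ of maximal common divisors of its coefficients is nonempty. (b) The polynomial semidomain $S[x]$ is quasi-atomic. (c) The Laurent polynomial semidomain $S[x^{\pm 1}]$ is quasi-atomic. Then (a) implies (b), and (b) implies (c). Moreover, (b) and (c) are equivalent.
   Context: A monoid here is a commutative cancellative semigroup with identity. A semiring is a set $S$ with two operations $+$ and $\cdot$ such that $(S,+)$ is a (commutative, cancellative) monoid with identity $0$, $(S,\cdot)$ is a commutative semigroup with identity $1$, and multiplication distributes over addition. A subsemiring of a semiring (or ring) is an additive submonoid that contains $1$ and is closed under multiplication. A semidomain is a semiring that is a subsemiring of an integral domain. For a semidomain $S$, write $S^* := (S\setminus\{0\},\cdot)$, which is a monoid, called the multiplicative monoid of $S$. $S[x]$ denotes the semiring of polynomials with coefficients in $S$, and $S[x^{\pm 1}]$ the semiring of Laurent polynomials with coefficients in $S$; both are semidomains. For a monoid $M$ (written multiplicatively), a unit is an invertible element; an atom of $M$ is a nonunit $a \in M$ such that $a = bc$ with $b,c\in M$ implies that $b$ or $c$ is a unit. The monoid $M$ is quasi-atomic if for every nonunit $c \in M$ there exists $b\in M$ such that $bc$ is a finite product of atoms of $M$. A semidomain $S$ is quasi-atomic if the monoid $S^*$ is quasi-atomic. A nonzero polynomial in $S[x]$ is indecomposable if it cannot be written as a product of two nonconstant polynomials in $S[x]$. For $c_0,\dots,c_n\in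 S$, not all zero, a common divisor of $c_0,\dots,c_n$ is an element $d \in S^*$ such that for each $i$ there is $s_i\in S$ with $c_i = d s_i$ (so every element of $S^*$ divides $0$). A common divisor $d$ is a maximal common divisor if every common divisor of $c_0/d,\dots,c_n/d$ is a unit of $S^*$. The set of maximal common divisors is denoted $\mathrm{mcd}_S(c_0,\dots,c_n)$. *)

(* Defs.v *)
From HB Require Import structures.
From mathcomp Require Import all_boot all_order all_algebra.
From mathcomp Require Import finmap.

Set Implicit Arguments.
Unset Strict Implicit.
Unset Printing Implicit Defensive.

Import GRing.Theory.

Local Open Scope ring_scope.

(* Being a subsemiring of an integral domain is expressed by an injective     *)
(* semiring morphism; it forces (S, +) to be cancellative and S not to have   *)
(* zero divisors.                                                             *)
Definition semidomain (S : comNzSemiRingType) : Prop :=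
  exists (R : idomainType) (f : {rmorphism S -> R}), injective f.

(* A commutative monoid is given as a set M of elements of a commutative      *)
(* semiring, under the multiplication of the semiring: M is meant to contain  *)
(* 1 and to be closed under products. It is used with M := nonzero S, which   *)
(* has these properties when S is a semidomain.                               *)
Section Monoids.
Context {S : comNzSemiRingType} (M : {pred S}).

Definition munit (u : S) : Prop :=
  u \in M /\ exists v : S, v \in M /\ u * v = 1.

Definition atom (a : S) : Prop :=
  [/\ a \in M, ~ munit a &
      forall b c : S, b \in M -> c \in M -> a = b * c -> munit b \/ munit c].

Definition quasi_atomic_monoid : Prop :=
  forall c : S, c \in M -> ~ munit c ->
  exists (b : S) (s : seq S),
    [/\ b \in M, forall a, a \in s -> atom a & b * c = \prod_(a <- s) a].

End Monoids.

Definition nonzero (S : comNzSemiRingType) : {pred S} := predC1 0.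
Arguments nonzero S : clear implicits.

Lemma nonzero_mulr_closed (S : comNzSemiRingType) :
  semidomain S -> GRing.mulr_closed (nonzero S).
Proof.
move=> [R [f f_inj]]; split=> [|x y]; first by rewrite inE /= oner_eq0.
by rewrite !inE -!(inj_eq f_inj) !rmorph0 rmorphM mulf_eq0 negb_or => -> ->.
Qed.

Definition quasi_atomic (S : comNzSemiRingType) : Prop :=
  quasi_atomic_monoid (nonzero S).

Section Divisors.
Context {S : comNzSemiRingType}.

Definition common_divisor (c : seq S) (d : S) : Prop :=
  d \in nonzero S /\ forall x, x \in c -> exists s : S, x = d * s.

(* There is no division in S: the sequence c_0 / d, ..., c_n / d is the q     *)
(* such that c = d * q termwise, which is unique when S is a semidomain.      *)
Definition mcd (c : seq S) (d : S) : Prop :=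
  common_divisor c d /\
  forall q : seq S, c = [seq d * x | x <- q] ->
  forall e : S, common_divisor q e -> munit (nonzero S) e.

Definition indecomposable (p : {poly S}) : Prop :=
  p != 0 /\
  ~ exists q r : {poly S}, [/\ (1 < size q)%N, (1 < size r)%N & p = q * r].

End Divisors.

(* Laurent polynomials as finitely supported families of coefficients indexed *)
(* by int: f k is the coefficient of x^k.                                     *)
Definition laurent (S : comNzSemiRingType) : Type :=
  {fsfun int -> S with 0}.

HB.instance Definition _ (S : comNzSemiRingType) := Choice.on (laurent S).

Section Laurent.
Context {S : comNzSemiRingType}.
Implicit Types (f g h : laurent S) (i j k : int).

Definition laurent_zero : laurent S := [fsfun].

Definition laurent_add f g : laurent S :=
  [fsfun k in (finsupp f `|` finsupp g)%fset => f k + g k | 0].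

Definition laurent_one : laurent S := [fsfun k in [fset (0 : int)]%fset => 1 | 0].

Definition laurent_mul f g : laurent S :=
  [fsfun k in [fset (i + j)%R | i in finsupp f, j in finsupp g]%fset =>
     \sum_(i <- finsupp f) f i * g (k - i) | 0].

Lemma laurent_zeroE k : laurent_zero k = 0.
Proof. by rewrite fsfun0E. Qed.

Lemma laurent_addE f g k : laurent_add f g k = f k + g k.
Proof.
rewrite fsfunE in_fsetU; case: ifP => // /negbT; rewrite negb_or => /andP[nf ng].
by rewrite !fsfun_dflt // addr0.
Qed.

Lemma laurent_oneE k : laurent_one k = (k == 0)%:R.
Proof. by rewrite fsfunE in_fset1; case: eqP. Qed.

Lemma laurent_mulE f g k :
  laurent_mul f g k = \sum_(i <- finsupp f) f i * g (k - i).
Proof.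
rewrite fsfunE; case: ifP => // /negbT nk.
rewrite big_seq big1 // => i fi.
rewrite [g _]fsfun_dflt ?mulr0 //; apply: contra nk => gk.
by apply/imfset2P; exists i => //; exists (k - i) => //; rewrite addrC subrK.
Qed.

Lemma sum_fset_pick (A : {fset int}) k (F : int -> S) :
  (k \notin A -> F k = 0) ->
  \sum_(i <- A) (if i == k then F i else 0) = F k.
Proof.
move=> Fk; have [kA|kA] := boolP (k \in A).
  rewrite (big_fsetD1 k kA) /= eqxx big_seq big1 ?addr0 // => i.
  by rewrite in_fsetD1 => /andP[/negPf->].
rewrite Fk // big_seq big1 // => i iA.
by case: eqP => // e; rewrite -e iA in kA.
Qed.

Lemma laurent_mulEr f g k :
  laurent_mul f g k = \sum_(j <- finsupp g) f (k - j) * g j.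
Proof.
rewrite laurent_mulE.
transitivity (\sum_(i <- finsupp f) \sum_(j <- finsupp g)
                 if j == k - i then f i * g j else 0).
  apply: eq_bigr => i _.
  rewrite (sum_fset_pick (F := fun j => f i * g j)) // => gk.
  by rewrite [g _]fsfun_dflt ?mulr0.
rewrite exchange_big /=; apply: eq_bigr => j _.
under eq_bigr => i _ do rewrite eq_sym subr_eq addrC -subr_eq eq_sym.
rewrite (sum_fset_pick (F := fun i => f i * g j)) // => fk.
by rewrite [f _]fsfun_dflt ?mul0r.
Qed.

Lemma laurent_addA : associative laurent_add.
Proof. by move=> f g h; apply/fsfunP => k; rewrite !laurent_addE addrA. Qed.

Lemma laurent_addC : commutative laurent_add.
Proof. by move=> f g; apply/fsfunP => k; rewrite !laurent_addE addrC. Qed.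

Lemma laurent_add0 : left_id laurent_zero laurent_add.
Proof.
by move=> f; apply/fsfunP => k; rewrite laurent_addE laurent_zeroE add0r.
Qed.

Lemma laurent_mulA : associative laurent_mul.
Proof.
move=> f g h; apply/fsfunP => k; rewrite laurent_mulE laurent_mulEr.
under eq_bigr do rewrite laurent_mulEr big_distrr /=.
rewrite exchange_big /=; apply: eq_bigr => j _.
rewrite laurent_mulE big_distrl /=; apply: eq_bigr => i _.
by rewrite mulrA addrAC.
Qed.

Lemma laurent_mulC : commutative laurent_mul.
Proof.
move=> f g; apply/fsfunP => k; rewrite laurent_mulE laurent_mulEr.
by apply: eq_bigr => i _; rewrite mulrC.
Qed.

Lemma laurent_mul1 : left_id laurent_one laurent_mul.
Proof.
move=> f; apply/fsfunP => k; rewrite laurent_mulEr.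
under eq_bigr => j _.
  rewrite laurent_oneE subr_eq0 eq_sym mulr_natl mulrb.
  over.
by apply: (sum_fset_pick (F := f)) => fk; rewrite fsfun_dflt.
Qed.

Lemma laurent_mulDl : left_distributive laurent_mul laurent_add.
Proof.
move=> f g h; apply/fsfunP => k; rewrite laurent_addE !laurent_mulEr.
by rewrite -big_split; apply: eq_bigr => j _; rewrite laurent_addE mulrDl.
Qed.

Lemma laurent_mul0 : left_zero laurent_zero laurent_mul.
Proof.
move=> f; apply/fsfunP => k; rewrite laurent_mulEr laurent_zeroE big1 // => j _.
by rewrite laurent_zeroE mul0r.
Qed.

Lemma laurent_one_neq0 : laurent_one != laurent_zero.
Proof.
apply/eqP => /fsfunP/(_ 0); rewrite laurent_oneE laurent_zeroE eqxx.
by move/eqP; rewrite oner_eq0.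
Qed.

HB.instance Definition _ := GRing.isNmodule.Build (laurent S)
  laurent_addA laurent_addC laurent_add0.

HB.instance Definition _ := GRing.Nmodule_isComNzSemiRing.Build (laurent S)
  laurent_mulA laurent_mulC laurent_mul1 laurent_mulDl laurent_mul0
  laurent_one_neq0.

End Laurent.

(* Main.v *)
(** Call [c] quasi-factorable when some nonzero multiple of [c] is a product of
    atoms; this property is closed under products and under nonzero divisors,
    and units have it.

    (a) -> (b): a polynomial is a product of indecomposable ones. If [d] is a
    maximal common divisor of the coefficients of a nonconstant indecomposable
    [p = d q], then [q] is an atom of [S[x]], while atoms of [S] remain atoms
    in [S[x]].

    (b) <-> (c): every nonzero Laurent polynomial is [x^k A] for a polynomial
    [A] with [A(0) <> 0], and both [k] and [A] are determined by it. For such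
    [A], [A] is an atom of [S[x]] if and only if [x^k A] is an atom of
    [S[x^{+-1}]]; the only other atoms of [S[x]] are the associates of [x]. *)

Require Import Defs.
From mathcomp Require Import all_boot all_order all_algebra.
From mathcomp Require Import finmap zify.
From Stdlib Require Import Classical.

Set Implicit Arguments.
Unset Strict Implicit.
Unset Printing Implicit Defensive.

Import GRing.Theory.

Local Open Scope ring_scope.

(** * Units and quasi-factorable elements of a semiring *)

Section QuasiFactorable.
Variable T : comNzSemiRingType.
Implicit Types (a b c u v : T) (s : seq T).

(** Since 1 is nonzero, [u * v = 1] already forces both factors to be nonzero. *)
Lemma munitP u : munit (nonzero T) u <-> exists v, u * v = 1.
Proof.
split=> [[_ [v [_ uv]]]|[v uv]]; first by exists v.
split; last exists v; rewrite ?inE; last split=> //; apply/eqP => z.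
  by move: uv; rewrite z mul0r => /esym/eqP; rewrite oner_eq0.
by move: uv; rewrite z mulr0 => /esym/eqP; rewrite oner_eq0.
Qed.

Lemma munit_mul u v :
  munit (nonzero T) u -> munit (nonzero T) v -> munit (nonzero T) (u * v).
Proof.
move=> /munitP[u' uu'] /munitP[v' vv']; apply/munitP; exists (u' * v').
by rewrite mulrACA uu' vv' mulr1.
Qed.

Lemma munit_mulr u v : munit (nonzero T) (u * v) -> munit (nonzero T) v.
Proof.
by move=> /munitP[w uvw]; apply/munitP; exists (u * w); rewrite mulrCA mulrA.
Qed.

Lemma munit_neq0 u : munit (nonzero T) u -> u != 0.
Proof. by case; rewrite inE. Qed.

Hypothesis nz : GRing.mulr_closed (nonzero T).

Lemma mulr_neq0 a b : a != 0 -> b != 0 -> a * b != 0.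
Proof. by case: nz => _ /(_ a b); rewrite !inE => h /h{}h /h. Qed.

Definition quasi_factorable c : Prop :=
  exists b s, [/\ b != 0, forall a, a \in s -> atom (nonzero T) a &
                  b * c = \prod_(a <- s) a].

Lemma quasi_factorable_unit u : munit (nonzero T) u -> quasi_factorable u.
Proof.
move=> [_ [v [v0 uv]]]; exists v, [::]; split=> //.
by rewrite big_nil mulrC.
Qed.

Lemma quasi_factorable1 : quasi_factorable 1.
Proof. by apply/quasi_factorable_unit/munitP; exists 1; rewrite mulr1. Qed.

Lemma quasi_factorable_atom a : atom (nonzero T) a -> quasi_factorable a.
Proof.
move=> aa; exists 1, [:: a]; split; first exact: oner_neq0.
  by move=> b; rewrite inE => /eqP->.
by rewrite big_seq1 mul1r.
Qed.

Lemma quasi_factorable_mul a b :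
  quasi_factorable a -> quasi_factorable b -> quasi_factorable (a * b).
Proof.
move=> [a' [s [a'0 sP sE]]] [b' [t [b'0 tP tE]]].
exists (a' * b'), (s ++ t); split; first exact: mulr_neq0.
  by move=> c; rewrite mem_cat => /orP[/sP|/tP].
by rewrite big_cat mulrACA sE tE.
Qed.

Lemma quasi_factorable_mulr a b :
  a != 0 -> quasi_factorable (a * b) -> quasi_factorable b.
Proof.
move=> a0 [c [s [c0 sP sE]]]; exists (c * a), s; split=> //.
  exact: mulr_neq0.
by rewrite -mulrA.
Qed.

Lemma quasi_factorable_prod s :
  (forall a, a \in s -> quasi_factorable a) ->
  quasi_factorable (\prod_(a <- s) a).
Proof.
move=> sP; rewrite big_seq; apply: big_ind => //.
  exact: quasi_factorable1.
by move=> a b; apply: quasi_factorable_mul.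
Qed.

(** Units, which [quasi_atomic] exempts, are quasi-factorable through the empty product, so no unit
    has to be singled out afterwards. *)
Lemma quasi_atomicP :
  quasi_atomic T <-> forall c, c != 0 -> quasi_factorable c.
Proof.
split=> [qT c c0|qT c c0 _]; last exact: qT.
have [/quasi_factorable_unit //|nu] := classic (munit (nonzero T) c).
exact: qT c c0 nu.
Qed.

End QuasiFactorable.

(** * Units, atoms and indecomposable factors in S[x] *)

Section Polynomials.
Variable S : comNzSemiRingType.
Hypothesis nz : GRing.mulr_closed (nonzero S).
Implicit Types p q r : {poly S}.

(** The product of the leading coefficients is nonzero, so degrees add. *)
Lemma size_mul_nz p q : p != 0 -> q != 0 -> size (p * q) = (size p + size q).-1.
Proof.
by move=> p0 q0; rewrite size_proper_mul // mulr_neq0 // lead_coef_eq0.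
Qed.

Lemma poly_mulr_closed : GRing.mulr_closed (nonzero {poly S}).
Proof.
split=> [|p q]; rewrite !inE ?oner_eq0 // => p0 q0.
rewrite -size_poly_gt0 size_mul_nz //.
by move: p0 q0; rewrite -!size_poly_gt0; lia.
Qed.

Lemma mulf_poly_neq0 p q : p * q != 0 -> (p != 0) /\ (q != 0).
Proof.
by move=> pq; split; apply: contra_neq pq => ->; rewrite ?mul0r ?mulr0.
Qed.

Lemma munit_polyC c : munit (nonzero {poly S}) c%:P <-> munit (nonzero S) c.
Proof.
split=> /munitP[v]; last first.
  by move=> cv; apply/munitP; exists v%:P; rewrite -polyCM cv.
move=> /(congr1 (fun p : {poly S} => p`_0)); rewrite coefCM coef1 eqxx => cv.
by apply/munitP; exists v`_0.
Qed.

Lemma munit_poly_size1 p : munit (nonzero {poly S}) p -> size p = 1%N.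
Proof.
move=> pu; have p0 := munit_neq0 pu; have [q pq] := (munitP _).1 pu.
have q0 : q != 0.
  by apply: contra_eq_neq pq => ->; rewrite mulr0 eq_sym oner_neq0.
have := size_mul_nz p0 q0; rewrite pq size_poly1.
by move: p0 q0; rewrite -!size_poly_gt0; lia.
Qed.

(** By degrees, the factors of a nonzero constant are constants, so every factorization of it
    already takes place in S. *)
Lemma atom_polyC a : atom (nonzero S) a -> atom (nonzero {poly S}) a%:P.
Proof.
move=> [a0 anu aP]; have a0' : a != 0 := a0; split.
- by rewrite inE polyC_eq0.
- by move/munit_polyC.
move=> p q; rewrite !inE => p0 q0 apq.
have := size_mul_nz p0 q0; rewrite -apq size_polyC a0' => sz.
have [sp sq] : (size p <= 1)%N /\ (size q <= 1)%N.
  by move: p0 q0 sz; rewrite -!size_poly_gt0; lia.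
move: p0 q0 apq; rewrite (size1_polyC sp) (size1_polyC sq) !polyC_eq0.
move=> p0 q0; rewrite -polyCM => /polyC_inj/aP.
by rewrite !inE => /(_ p0 q0) [] u; [left|right]; apply/munit_polyC.
Qed.

Lemma quasi_factorable_polyC c :
  quasi_factorable c -> quasi_factorable (c%:P : {poly S}).
Proof.
move=> [b [s [b0 sP sE]]]; exists b%:P, [seq a%:P | a <- s]; split.
- by rewrite polyC_eq0.
- by move=> _ /mapP[a /sP sa ->]; apply: atom_polyC.
- by rewrite -polyCM sE rmorph_prod big_map.
Qed.

(** By degrees one factor is constant; it divides the coefficient 1 of x, so it is a unit. *)
Lemma atom_polyX : atom (nonzero {poly S}) 'X.
Proof.
have const p q : 'X = p * q -> (size p <= 1)%N -> munit (nonzero {poly S}) p.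
  move=> Xpq /size1_polyC pE; move: Xpq; rewrite pE.
  move=> /(congr1 (fun r : {poly S} => r`_1)); rewrite coefX coefCM => pq.
  by apply/munit_polyC/munitP; exists q`_1.
split; first by rewrite inE polyX_eq0.
  by move/munit_poly_size1; rewrite size_polyX.
move=> p q; rewrite !inE => p0 q0 Xpq.
have := size_mul_nz p0 q0; rewrite -Xpq size_polyX => sz.
have [sp|sp] := leqP (size p) 1; first by left; apply: const Xpq sp.
by right; apply: (const q p); [rewrite mulrC | lia].
Qed.

(** Strong induction on the size: two nonconstant factors both have smaller size than their
    product. *)
Lemma indecomposable_ind (P : {poly S} -> Prop) :
  (forall p q, P p -> P q -> P (p * q)) ->
  (forall p, indecomposable p -> P p) ->
  forall p, p != 0 -> P p.
Proof.
move=> Pmul Pind p; have [n] := ubnP (size p); elim: n p => // n IHn p pn p0.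
have [|nind] := classic (indecomposable p); first exact: Pind.
have [[q [r [q1 r1 pqr]]]|nd] := classic (exists q r : {poly S},
  [/\ (1 < size q)%N, (1 < size r)%N & p = q * r]); last by case: nind.
have [q0 r0] : (q != 0) /\ (r != 0) by apply: mulf_poly_neq0; rewrite -pqr.
have := size_mul_nz q0 r0; rewrite -pqr => sz.
by rewrite pqr; apply: Pmul; apply: IHn => //; lia.
Qed.

(** * Maximal common divisors and the implication from (a) to (b) *)

Lemma common_divisor_quotient (c : seq S) d :
  common_divisor c d -> exists s : seq S, c = [seq d * x | x <- s].
Proof.
move=> [_]; elim: c => [|x c IHc] dP; first by exists [::].
have [s ->] := IHc (fun y yc => dP y (mem_behead (s := x :: c) yc)).
have [y ->] := dP x (mem_head _ _).
by exists (y :: s).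
Qed.

(** A constant factor of the quotient q divides all its coefficients, so it is a unit by maximality
    of [d]; two nonconstant factors of q would decompose [p]. *)
Lemma mcd_atom p d : indecomposable p -> (1 < size p)%N -> mcd p d ->
  exists2 q, atom (nonzero {poly S}) q & p = d%:P * q.
Proof.
move=> [p0 pind] p1 [dcd dmax]; have [s sE] := common_divisor_quotient dcd.
have d0 : d != 0 by case: dcd.
have pE : p = d%:P * Poly s.
  apply/polyP => i; rewrite coefCM coef_Poly.
  have [si|si] := ltnP i (size s); first by rewrite sE (nth_map 0).
  by rewrite !nth_default ?mulr0 // sE size_map.
have [_ q0] : (d%:P != 0 :> {poly S}) /\ (Poly s != 0).
  by apply: mulf_poly_neq0; rewrite -pE.
have dP0 : d%:P != 0 :> {poly S} by rewrite polyC_eq0.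
have szp : size p = size (Poly s).
  by rewrite pE size_mul_nz // size_polyC d0.
have const e r : Poly s = e * r -> (size e <= 1)%N ->
    munit (nonzero {poly S}) e.
  move=> qer /size1_polyC eE; rewrite eE; apply/munit_polyC.
  apply: (dmax s sE); split.
    rewrite inE; apply: contra_neq q0 => e0.
    by rewrite qer eE e0 mul0r.
  move=> x /(nthP 0)[i si <-]; exists r`_i.
  by rewrite -coefCM -eE -qer coef_Poly.
exists (Poly s) => //; split; first by rewrite inE.
  by move/munit_poly_size1 => sz; rewrite szp sz in p1.
move=> b c _ _ qbc.
have [sb|sb] := leqP (size b) 1; first by left; apply: const qbc sb.
right; apply: (const c b); first by rewrite mulrC.
rewrite leqNgt; apply/negP => sc; apply: pind; exists (d%:P * b), c.
have [b0 _] : (b != 0) /\ (c != 0) by apply: mulf_poly_neq0; rewrite -qbc.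
split=> //; last by rewrite -mulrA -qbc.
by rewrite size_mul_nz // size_polyC d0.
Qed.

Lemma poly_quasi_atomic :
  quasi_atomic S -> (forall p, indecomposable p -> exists d, mcd p d) ->
  quasi_atomic {poly S}.
Proof.
move=> qS mcdS; have qSP := (quasi_atomicP S).1 qS.
apply/quasi_atomicP; apply: indecomposable_ind => [p q|p pind].
  exact/quasi_factorable_mul/poly_mulr_closed.
(* Nonzero constants count as indecomposable too; they are quasi-factorable already in S. *)
have [p0 _] := pind; have [sp|sp] := leqP (size p) 1.
  rewrite (size1_polyC sp) in p0 *; apply: quasi_factorable_polyC.
  by apply: qSP; rewrite -polyC_eq0.
have [d dP] := mcdS p pind; have [q qa ->] := mcd_atom pind sp dP.
apply: quasi_factorable_mul; first exact: poly_mulr_closed.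
  by apply/quasi_factorable_polyC/qSP; case: dP => [[]].
exact: quasi_factorable_atom.
Qed.

End Polynomials.

(** * Monomials and the embedding of S[x] into the Laurent polynomials *)

Section Laurent.
Variable S : comNzSemiRingType.
Implicit Types (p q A B : {poly S}) (f g : laurent S) (i j k : int).

Definition monom (c : S) k : laurent S := [fsfun i in [fset k]%fset => c | 0].

Lemma monomE c k i : monom c k i = if i == k then c else 0.
Proof. by rewrite fsfunE in_fset1. Qed.

Lemma monom_mulE c k f i : (monom c k * f) i = c * f (i - k).
Proof.
have -> : (monom c k * f) i = laurent_mul (monom c k) f i by [].
rewrite laurent_mulE.
under eq_bigr => j _ do rewrite monomE (fun_if (fun y => y * f (i - j))) mul0r.
rewrite (sum_fset_pick (F := fun j => c * f (i - j))) //.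
(* The exponent [k] is missing from the support only if [c = 0], and then the picked term vanishes
   as well. *)
by rewrite mem_finsupp negbK monomE eqxx => /eqP->; rewrite mul0r.
Qed.

Lemma laurent_addrE f g i : (f + g) i = f i + g i.
Proof. exact: laurent_addE. Qed.

Lemma laurent0E i : (0 : laurent S) i = 0.
Proof. exact: laurent_zeroE. Qed.

Lemma monom0 : monom 1 0 = 1.
Proof. by []. Qed.

Lemma monomM k j : monom 1 k * monom 1 j = monom 1 (k + j).
Proof.
by apply/fsfunP => i; rewrite monom_mulE !monomE mul1r subr_eq addrC.
Qed.

Lemma monomK k f : monom 1 (- k) * (monom 1 k * f) = f.
Proof. by rewrite mulrA monomM addNr monom0 mul1r. Qed.

Lemma munit_monom k : munit (nonzero (laurent S)) (monom 1 k).
Proof.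
by apply/munitP; exists (monom 1 (- k)); rewrite monomM subrr monom0.
Qed.

(** The inclusion of S[x] in S[x^{+-1}]; [absz] is harmless because the exponents listed are
    nonnegative. *)
Definition laurent_poly p : laurent S :=
  [fsfun k in [fset Posz n | n in iota 0 (size p)]%fset => p`_(absz k) | 0].

Lemma laurent_polyE p k :
  laurent_poly p k = if k is Posz n then p`_n else 0.
Proof.
rewrite fsfunE; case: ifP => [/imfsetP[n _ ->] //|].
case: k => // n /negbT kn; rewrite nth_default // leqNgt.
apply: contra kn => kn; apply/imfsetP; exists n => //.
by rewrite /= mem_iota.
Qed.

Lemma laurent_poly_inj : injective laurent_poly.
Proof.
move=> p q pq; apply/polyP => n.
by have := laurent_polyE p n; rewrite pq laurent_polyE.
Qed.

Lemma laurent_polyD p q :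
  laurent_poly (p + q) = laurent_poly p + laurent_poly q.
Proof.
apply/fsfunP => -[] n; rewrite laurent_addrE !laurent_polyE ?addr0 //.
by rewrite coefD.
Qed.

Lemma laurent_poly0 : laurent_poly 0 = 0.
Proof.
by apply/fsfunP => -[] n; rewrite laurent_polyE laurent0E ?coef0.
Qed.

Lemma laurent_polyC c : laurent_poly c%:P = monom c 0.
Proof.
by apply/fsfunP => -[] n; rewrite laurent_polyE monomE // coefC.
Qed.

Lemma laurent_polyXnM n p :
  laurent_poly ('X^n * p) = monom 1 n * laurent_poly p.
Proof.
apply/fsfunP => i; rewrite monom_mulE mul1r !laurent_polyE.
case: i => m; last by case E: (_ - _) => [k|k] //; lia.
rewrite coefXnM; case: ltnP => mn.
  by case E: (_ - _) => [k|k] //; lia.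
by rewrite subzn.
Qed.

(** Induction along Horner's scheme leaves only products with x and with constants. *)
Lemma laurent_polyM p q :
  laurent_poly (p * q) = laurent_poly p * laurent_poly q.
Proof.
elim/poly_ind: p => [|p c IHp].
  by rewrite laurent_poly0 !mul0r laurent_poly0.
have CM : laurent_poly (c%:P * q) = monom c 0 * laurent_poly q.
  apply/fsfunP => i; rewrite monom_mulE subr0 !laurent_polyE.
  by case: i => n; rewrite ?coefCM ?mulr0.
have XM r : laurent_poly (r * 'X) = monom 1 1 * laurent_poly r.
  by rewrite -laurent_polyXnM mulrC.
rewrite mulrDl !laurent_polyD mulrAC !XM IHp CM laurent_polyC.
by rewrite mulrDl mulrA.
Qed.

Lemma laurent_poly1 : laurent_poly 1 = 1.
Proof. by rewrite laurent_polyC monom0. Qed.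

Lemma laurent_poly_eq0 p : (laurent_poly p == 0) = (p == 0).
Proof. by rewrite -laurent_poly0 (inj_eq laurent_poly_inj). Qed.

(** * The normal form x^k A with A(0) nonzero *)

Lemma poly_order p : p != 0 -> exists n A, A`_0 != 0 /\ p = 'X^n * A.
Proof.
move=> p0.
(* The order of [p] is the least exponent with a nonzero coefficient. *)
have ex : exists n, p`_n != 0.
  by exists (size p).-1; rewrite -lead_coefE lead_coef_eq0.
case: (ex_minnP ex) => n pn nmin; exists n, (drop_poly n p).
rewrite coef_drop_poly; split=> //.
rewrite -[LHS](poly_take_drop n) mulrC [take_poly n p](_ : _ = 0) ?add0r //.
apply/polyP => i; rewrite coef_take_poly coef0; case: ifP => // ilt.
by apply/eqP/negPn/negP => /nmin; rewrite leqNgt ilt.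
Qed.

Lemma laurent_normal_form f : f != 0 ->
  exists k A, A`_0 != 0 /\ f = monom 1 k * laurent_poly A.
Proof.
(* Any bound on the absolute values of the exponents of [f] would do; the sum is one. *)
move=> f0; pose n := (\sum_(i <- finsupp f) absz i)%N.
have le_n i : f i != 0 -> (absz i <= n)%N.
  rewrite -mem_finsupp => fi; rewrite /n (big_fsetD1 i fi) /=.
  exact: leq_addr.
(* This is x^n f, whose exponents lie between 0 and 2n. *)
pose p := \poly_(i < (n + n).+1) f (i%:Z - n%:Z).
have fE : monom 1 n * f = laurent_poly p.
  apply/fsfunP => i; rewrite monom_mulE mul1r laurent_polyE.
  have := le_n (i - n%:Z); case: i => m fm; last first.
    by apply/eqP/negPn/negP => /fm; lia.
  rewrite coef_poly; case: ltnP => // nm.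
  by apply/eqP/negPn/negP => /fm; lia.
have p0 : p != 0.
  rewrite -laurent_poly_eq0 -fE; apply: contra_neq f0 => fn.
  by rewrite -(monomK n f) fn mulr0.
have [m [A [A0 pA]]] := poly_order p0; exists (- n%:Z + m%:Z), A; split=> //.
by rewrite -(monomK n f) fE pA laurent_polyXnM mulrA monomM.
Qed.

Lemma laurent_normal_form_uniq k j A B : A`_0 != 0 -> B`_0 != 0 ->
  monom 1 k * laurent_poly A = monom 1 j * laurent_poly B -> k = j /\ A = B.
Proof.
(* The left side has the nonzero coefficient p(0) at exponent [i], while the right side vanishes
   below [l]. *)
have le i l p q : p`_0 != 0 ->
    monom 1 i * laurent_poly p = monom 1 l * laurent_poly q -> l <= i.
  move=> p0 /fsfunP/(_ i); rewrite !monom_mulE !mul1r subrr !laurent_polyE.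
  case E: (i - l) => [m|m] pz; first lia.
  by case: (negP p0); apply/eqP.
move=> A0 B0 AB; have kj : k = j.
  by have := le _ _ _ _ A0 AB; have := le _ _ _ _ B0 (esym AB); lia.
split=> //; apply: laurent_poly_inj.
by rewrite -(monomK k (laurent_poly A)) AB kj monomK.
Qed.

(** * Units and atoms in terms of the normal form *)

Hypothesis nz : GRing.mulr_closed (nonzero S).

Let nzP := poly_mulr_closed nz.

Lemma coef0_neq0 A : A`_0 != 0 -> A != 0.
Proof. by apply: contra_neq => ->; rewrite coef0. Qed.

Lemma coef0M_neq0 A B : A`_0 != 0 -> B`_0 != 0 -> (A * B)`_0 != 0.
Proof. by rewrite coef0M; apply: mulr_neq0. Qed.

Lemma monom_laurent_poly_neq0 k p :
  p != 0 -> monom 1 k * laurent_poly p != 0.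
Proof.
rewrite -laurent_poly_eq0; apply: contra_neq => e.
by rewrite -(monomK k (laurent_poly p)) e mulr0.
Qed.

Lemma laurent_mulr_closed : GRing.mulr_closed (nonzero (laurent S)).
Proof.
split=> [|f g]; rewrite !inE ?oner_eq0 //.
move=> /laurent_normal_form[k [A [A0 ->]]] /laurent_normal_form[j [B [B0 ->]]].
rewrite mulrACA monomM -laurent_polyM monom_laurent_poly_neq0 //.
by apply/coef0_neq0/coef0M_neq0.
Qed.

Let nzL := laurent_mulr_closed.

Lemma munit_laurent_poly A :
  munit (nonzero {poly S}) A -> munit (nonzero (laurent S)) (laurent_poly A).
Proof.
move=> /munitP[B AB]; apply/munitP; exists (laurent_poly B).
by rewrite -laurent_polyM AB laurent_poly1.
Qed.

Lemma munit_laurent_normal_form k A : A`_0 != 0 ->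
  munit (nonzero (laurent S)) (monom 1 k * laurent_poly A) <->
  munit (nonzero {poly S}) A.
Proof.
move=> A0; split=> [/munit_mulr u|u]; last first.
  exact/munit_mul/munit_laurent_poly/u/munit_monom.
have [_ [f [f0]]] := u.
(* With the inverse of A written as x^j B, uniqueness applied to x^j (A B) = x^0 1 gives A B = 1. *)
have [j [B [B0 ->]]] := laurent_normal_form f0.
rewrite mulrCA -laurent_polyM -laurent_poly1 => AB.
apply/munitP; exists B.
have [] // := @laurent_normal_form_uniq j 0 (A * B) 1.
- exact: coef0M_neq0.
- by rewrite coef1 oner_neq0.
- by rewrite AB monom0 mul1r.
Qed.

(** Factors of [A] have nonzero constant term, so they are in normal form; conversely, factors x^i B
    and x^j C of x^k A satisfy A = B C by uniqueness. *)
Lemma atom_laurent_normal_form k A : A`_0 != 0 ->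
  atom (nonzero (laurent S)) (monom 1 k * laurent_poly A) <->
  atom (nonzero {poly S}) A.
Proof.
move=> A0; split=> [[_ nu aP]|[_ nu aP]]; split.
- exact: coef0_neq0.
- by move=> /(munit_laurent_normal_form k A0).
- move=> B C nzB nzC ABC; move: A0; rewrite ABC coef0M => BC0.
  have B0 : B`_0 != 0 by apply: contra_neq BC0 => ->; rewrite mul0r.
  have C0 : C`_0 != 0 by apply: contra_neq BC0 => ->; rewrite mulr0.
  (* The unit x^k is absorbed into the first factor; x^0 only puts the second one in normal form. *)
  have [||| /(munit_laurent_normal_form k B0) u|
            /(munit_laurent_normal_form 0 C0) u] :=
    aP (monom 1 k * laurent_poly B) (monom 1 0 * laurent_poly C).
  + exact: monom_laurent_poly_neq0.
  + exact: monom_laurent_poly_neq0.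
  + by rewrite monom0 mul1r -mulrA -laurent_polyM ABC.
  + by left.
  + by right.
- exact/monom_laurent_poly_neq0/coef0_neq0.
- by move=> /(munit_laurent_normal_form k A0).
- move=> f g /laurent_normal_form[i [B [B0 ->]]].
  move=> /laurent_normal_form[j [C [C0 ->]]].
  rewrite mulrACA monomM -laurent_polyM.
  move=> /(laurent_normal_form_uniq A0 (coef0M_neq0 B0 C0))[_ /aP].
  case; [exact: coef0_neq0 | exact: coef0_neq0 |..] => u; [left|right].
    exact/munit_laurent_normal_form.
  exact/munit_laurent_normal_form.
Qed.

(** * Transfer of quasi-factorability between S[x] and S[x^{+-1}] *)

(** An atom of S[x] becomes a Laurent atom if its constant term is nonzero and a unit otherwise;
    both are quasi-factorable. *)
Lemma quasi_factorable_laurent_poly p :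
  quasi_factorable p -> quasi_factorable (laurent_poly p).
Proof.
move=> [b [s [b0 sP sE]]].
apply: (quasi_factorable_mulr nzL (a := laurent_poly b)).
  by rewrite laurent_poly_eq0.
rewrite -laurent_polyM sE (big_morph _ laurent_polyM laurent_poly1).
rewrite -(big_map laurent_poly xpredT id).
apply: quasi_factorable_prod => // _ /mapP[a /sP aa ->].
have [a0|a0] := eqVneq a`_0 0; last first.
  apply: quasi_factorable_atom.
  by rewrite -[laurent_poly a]mul1r -monom0; apply/atom_laurent_normal_form.
(* Here x divides the atom [a], so [a] is an associate of x, hence a unit. *)
apply: quasi_factorable_unit.
have [nza _ aP] := aa; have [[|n] [A [A0 aE]]] := poly_order nza.
  by rewrite expr0 mul1r in aE; rewrite -aE a0 eqxx in A0.
rewrite aE laurent_polyXnM; apply/munit_laurent_normal_form => //.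
have [_ nzXA] : (('X : {poly S}) != 0) /\ ('X^n * A != 0).
  by apply: mulf_poly_neq0; rewrite mulrA -exprS -aE.
have [||||] := aP 'X ('X^n * A).
- by rewrite inE polyX_eq0.
- by [].
- by rewrite aE exprS mulrA.
- by move/(munit_poly_size1 nz); rewrite size_polyX.
- exact: munit_mulr.
Qed.

(** Each Laurent atom is x^j A with A an atom of S[x]; the powers of x are collected in front. *)
Lemma laurent_atoms_normal_form (s : seq (laurent S)) :
  (forall a, a \in s -> atom (nonzero (laurent S)) a) ->
  exists k p, quasi_factorable p /\
    \prod_(a <- s) a = monom 1 k * laurent_poly p.
Proof.
elim: s => [|a s IHs] sP.
  exists 0, 1; rewrite big_nil monom0 laurent_poly1 mul1r; split=> //.
  exact: quasi_factorable1.
have [b bs|k [p [pq pE]]] := IHs; first by apply: sP; rewrite inE bs orbT.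
have aa := sP a (mem_head _ _); have [nza _ _] := aa.
have [j [A [A0 aE]]] := laurent_normal_form nza.
exists (j + k), (A * p); split.
  apply: quasi_factorable_mul => //; apply: quasi_factorable_atom.
  by apply/(atom_laurent_normal_form j A0); rewrite -aE.
by rewrite big_cons pE aE mulrACA monomM laurent_polyM.
Qed.

Lemma quasi_factorable_of_laurent_poly p :
  quasi_factorable (laurent_poly p) -> quasi_factorable p.
Proof.
move=> [b [s [b0 sP]]].
have [k [q [qq ->]]] := laurent_atoms_normal_form sP.
have [j [B [B0 ->]]] := laurent_normal_form b0.
rewrite -mulrA -laurent_polyM => bp.
(* Multiplying x^j B p = x^k q by x^(m - j), with [m] large, makes both exponents nonnegative and
   brings the equation back to S[x]. *)
have [n [m nm]] : exists n m : nat, n%:Z = m%:Z - j + k.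
  by exists (absz ((absz j + absz k)%N%:Z - j + k)), (absz j + absz k)%N; lia.
have {bp} Xp : ('X^m * B) * p = 'X^n * q.
  apply: laurent_poly_inj; rewrite -mulrA !laurent_polyXnM nm.
  by rewrite -[laurent_poly (B * p)](monomK j) bp !mulrA !monomM.
apply: (quasi_factorable_mulr nzP (a := 'X^m * B)).
  apply: mulr_neq0 => //; last exact: coef0_neq0.
  by rewrite monic_neq0 // monicXn.
rewrite Xp; apply: quasi_factorable_mul => //.
(* The remaining factor x^n is a product of copies of the atom x. *)
elim: (n) => [|l IHl].
  exact: quasi_factorable1.
rewrite exprS; apply: quasi_factorable_mul => //.
exact/quasi_factorable_atom/atom_polyX.
Qed.

Lemma laurent_quasi_atomicP :
  quasi_atomic {poly S} <-> quasi_atomic (laurent S).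
Proof.
split=> /quasi_atomicP q; apply/quasi_atomicP => f f0.
  have [k [A [A0 ->]]] := laurent_normal_form f0.
  apply: quasi_factorable_mul => //.
    exact/quasi_factorable_unit/munit_monom.
  exact/quasi_factorable_laurent_poly/q/coef0_neq0.
by apply/quasi_factorable_of_laurent_poly/q; rewrite laurent_poly_eq0.
Qed.

End Laurent.

Theorem theorem5p3 (S : comNzSemiRingType) (hS : semidomain S) :
  let a := quasi_atomic S /\
           forall p : {poly S}, indecomposable p -> exists d : S, mcd p d in
  let b := quasi_atomic {poly S} in
  let c := quasi_atomic (laurent S) in
  [/\ a -> b, b -> c & b <-> c].
Proof.
have nz := nonzero_mulr_closed hS; have bc := laurent_quasi_atomicP nz.
move=> a b c; split=> [[]||] //; last exact/bc.1.
exact: poly_quasi_atomic.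
Qed.
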